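(* Let $a<b$ and $N\ge1$ be integers, $\mathbf{I}=\{a,\dots,b\}$, $\mathbf{I}^*=\{a+\tfrac12,\dots,b-\tfrac12\}$. Let $\Omega$ be the rectangular box $\mathbf{I}\times\{0,\dots,N\}$, let $\mathfrak{b}$ be the set of edges of its bottom side (identified with $\mathbf{I}^*$), and let $P:(\mathbb{R}^2)^{\mathbf{I}^*}\to(\mathbb{R}^2)^{\mathbf{I}^*}$ be the s-holomorphic propagator. Decompose the $N$-th power $P^N$ into four $|\mathbf{I}^*|\times|\mathbf{I}^*|$ blocks $$P^N=\begin{pmatrix}P^N_{\Re\Re}&P^N_{\Re\Im}\\P^N_{\Im\Re}&P^N_{\Im\Im}\end{pmatrix}$$ corresponding to the decomposition $(\mathbb{R}^2)^{\mathbf{I}^*}\cong\mathbb{R}^{\mathbf{I}^*}\oplus i\mathbb{R}^{\mathbf{I}^*}$ into real and imaginary parts (so $P^N_{\Im\Re}$ maps the real component of the input to the imaginary component of the output). Then $$U_\Omega^{\mathfrak{b}}=-\left(P^N_{\Im\Im}\right)^{-1}P^N_{\Im\Re}.$$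
   Context: Edges are identified with their midpoints in $\mathbb{C}$. With $\lambda=e^{i\pi/4}$, a function $F$ on edges is s-holomorphic if for every face, with center $c$ and edges $E=c+\frac12$, $N=c+\frac i2$, $W=c-\frac12$, $S=c-\frac i2$: $F(N)+\lambda\overline{F(N)}=F(E)+\lambda\overline{F(E)}$, $F(N)+\lambda^{-1}\overline{F(N)}=F(W)+\lambda^{-1}\overline{F(W)}$, $F(S)+\lambda^{3}\overline{F(S)}=F(E)+\lambda^{3}\overline{F(E)}$, $F(S)+\lambda^{-3}\overline{F(S)}=F(W)+\lambda^{-3}\overline{F(W)}$. For a boundary edge $z$ of a box, $\tau_{cw}(z)\in\{\pm1,\pm i\}$ is the clockwise unit tangent of the boundary and $\tau_{ccw}=-\tau_{cw}$; $f\parallel\tau^{-1/2}$ means $f(z)\in\mathbb{R}\,\tau(z)^{-1/2}$. **Propagator.** Every $f:\{k:k\in\mathbf{I}^*\}\to\mathbb{C}$ (values on the horizontal edges of row $0$) has a unique s-holomorphic extension $h$ to the edges of $\mathbf{I}\times\{0,1\}$ (horizontal edges of rows $0$ and $1$ and vertical edges $x+\frac i2$, $x\in\mathbf{I}$) with $h\parallel\tau_{cw}^{-1/2}$ on the two vertical boundary edges, i.e. $h(a+\frac i2)\in\mathbb{R}\lambda^{-1}$, $h(b+\frac i2)\in\mathbb{R}\lambda$. $P$ is the real-linear map $f\mapsto(k\mapsto h(k+i))$. **RPS operator.** For $\Omega$ with edges $\mathcal{E}$ and $\mathfrak{b}\subset\partial\mathcal{E}$: $\mathcal{R}^{\mathfrak{b}}_\Omega$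 (resp. $\mathcal{I}^{\mathfrak{b}}_\Omega$) is the real space of $f:\mathfrak{b}\to\mathbb{C}$ with $f\parallel\tau_{ccw}^{-1/2}$ (resp. $\tau_{cw}^{-1/2}$) on $\mathfrak{b}$. For $u\in\mathcal{R}^{\mathfrak{b}}_\Omega$ there is a unique $v\in\mathcal{I}^{\mathfrak{b}}_\Omega$ such that $u+v$ has an s-holomorphic extension $h:\mathcal{E}\to\mathbb{C}$ with $h\parallel\tau_{cw}^{-1/2}$ on $\partial\mathcal{E}\setminus\mathfrak{b}$; $U^{\mathfrak{b}}_\Omega:\mathcal{R}^{\mathfrak{b}}_\Omega\to\mathcal{I}^{\mathfrak{b}}_\Omega$ is the map $u\mapsto v$. Here $\mathfrak{b}$ is the bottom side, so $\mathcal{R}^{\mathfrak{b}}_\Omega=\mathbb{R}^{\mathbf{I}^*}$ (purely real functions) and $\mathcal{I}^{\mathfrak{b}}_\Omega=i\mathbb{R}^{\mathbf{I}^*}$ (purely imaginary functions). *)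

(* Defs.v *)
From HB Require Import structures.
From mathcomp Require Import all_boot all_order all_algebra.
From mathcomp Require Import all_classical all_reals all_analysis.
From mathcomp Require Import complex.

Set Implicit Arguments.
Unset Strict Implicit.
Unset Printing Implicit Defensive.

Import Order.TTheory GRing.Theory Num.Theory.

Local Open Scope ring_scope.
Local Open Scope complex_scope.

(* The box is {a, ..., b} x {0, ..., n}.  Its columns of faces are numbered by
   'I_(ncol a b): the element of I^* with number k is a + k + 1/2. *)
Definition ncol (a b : int) : nat := `|b - a|%N.

Section Box.
Variables (a b : int) (n : nat).

(* inl (k, y) is the horizontal edge over a + k + 1/2 at height y;
   inr (x, y) is the vertical edge at abscissa a + x and height y + 1/2. *)
Definition edge : Type :=
  ('I_(ncol a b) * 'I_n.+1 + 'I_(ncol a b).+1 * 'I_n)%type.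

Definition face : Type := ('I_(ncol a b) * 'I_n)%type.

Definition horizontal (e : edge) : bool := if e is inl _ then true else false.

Definition bottom_edge (k : 'I_(ncol a b)) : edge := inl (k, ord0).
Definition top_edge (k : 'I_(ncol a b)) : edge := inl (k, ord_max).

Definition is_bottom (e : edge) : bool :=
  if e is inl (_, y) then y == ord0 else false.

Definition boundary (e : edge) : bool :=
  match e with
  | inl (_, y) => (y == ord0) || (y == ord_max)
  | inr (x, _) => (x == ord0) || (x == ord_max)
  end.

Variable R : realType.

Definition midpoint (e : edge) : R[i] :=
  match e with
  | inl (k, y) => (a%:~R + k%:R + 2^-1) +i* y%:R
  | inr (x, y) => (a%:~R + x%:R) +i* (y%:R + 2^-1)
  end.

Definition face_center (q : face) : R[i] :=
  (a%:~R + q.1%:R + 2^-1) +i* (q.2%:R + 2^-1).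

Definition lambda : R[i] := cos (pi / 4) +i* sin (pi / 4).

Definition s_holomorphic (F : {ffun edge -> R[i]}) : Prop :=
  forall (q : face) (E N W S : edge),
    midpoint E = face_center q + 2^-1 -> midpoint N = face_center q + 'i%C / 2 ->
    midpoint W = face_center q - 2^-1 -> midpoint S = face_center q - 'i%C / 2 ->
    [/\ F N + lambda * (F N)^* = F E + lambda * (F E)^*,
        F N + lambda^-1 * (F N)^* = F W + lambda^-1 * (F W)^*,
        F S + lambda ^+ 3 * (F S)^* = F E + lambda ^+ 3 * (F E)^* &
        F S + lambda ^- 3 * (F S)^* = F W + lambda ^- 3 * (F W)^*].

(* Relevant for boundary edges only (n > 0 and a < b, so that the four sides
   are disjoint); the value on interior edges is junk. *)
Definition tau_cw (e : edge) : R[i] :=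
  match e with
  | inl (_, y) => if y == ord0 then -1 else 1
  | inr (x, _) => if x == ord0 then 'i%C else - 'i%C
  end.

Definition tau_ccw (e : edge) : R[i] := - tau_cw e.

(* z \in R tau^{-1/2}; the choice of the square root does not matter. *)
Definition parallel_invsqrt (z tau : R[i]) : Prop :=
  exists (s : R[i]) (r : R), s ^+ 2 = tau^-1 /\ z = r%:C * s.

End Box.

Section Operators.
Variables (R : realType) (a b : int).
Local Notation m := (ncol a b).

(* Functions on I^* are column vectors. *)

Definition propagator_ext (f : 'cV[R[i]]_m) : set {ffun edge a b 1 -> R[i]} :=
  [set h | [/\ s_holomorphic h,
     forall k, h (bottom_edge 1 k) = f k 0 &
     forall e, boundary e -> ~~ horizontal e ->
       parallel_invsqrt (h e) (tau_cw R e)]].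

(* propagator_ext f is a singleton when a < b; P f is the trace of its unique
   element on row 1. *)
Definition propagator (f : 'cV[R[i]]_m) : 'cV[R[i]]_m :=
  \col_k (xget [ffun=> 0] (propagator_ext f)) (top_edge 1 k).

Definition space_R (n : nat) : set 'cV[R[i]]_m :=
  [set f | forall k, parallel_invsqrt (f k 0) (tau_ccw R (bottom_edge n k))].

Definition space_I (n : nat) : set 'cV[R[i]]_m :=
  [set f | forall k, parallel_invsqrt (f k 0) (tau_cw R (bottom_edge n k))].

Definition RPS_graph (n : nat) (u : 'cV[R[i]]_m) : set 'cV[R[i]]_m :=
  [set v | space_I n v /\
     exists h : {ffun edge a b n -> R[i]},
       [/\ s_holomorphic h,
           forall k, h (bottom_edge n k) = (u + v) k 0 &
           forall e, boundary e -> ~~ is_bottom e ->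
             parallel_invsqrt (h e) (tau_cw R e)]].

(* RPS_graph n u is a singleton when u is in space_R n, a < b and n > 0. *)
Definition RPS (n : nat) (u : 'cV[R[i]]_m) : 'cV[R[i]]_m :=
  xget 0 (RPS_graph n u).

End Operators.

Section RealCoordinates.
Variables (R : realType) (m : nat).

Definition re_col (f : 'cV[R[i]]_m) : 'cV[R]_m := map_mx (@complex.Re R) f.
Definition im_col (f : 'cV[R[i]]_m) : 'cV[R]_m := map_mx (@complex.Im R) f.

(* C^m = R^m (+) i R^m, real parts on top. *)
Definition to_real (f : 'cV[R[i]]_m) : 'cV[R]_(m + m) :=
  col_mx (re_col f) (im_col f).
Definition of_real (w : 'cV[R]_(m + m)) : 'cV[R[i]]_m :=
  \col_k (usubmx w k 0 +i* dsubmx w k 0).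

(* The matrix of a real-linear endomorphism of C^m, acting on columns. *)
Definition real_mx (T : 'cV[R[i]]_m -> 'cV[R[i]]_m) : 'M[R]_(m + m) :=
  \matrix_(i, j) to_real (T (of_real (delta_mx j 0))) i 0.

End RealCoordinates.

(* Main.v *)
(* Writing F = x + iy and t = tan(pi/8), s-holomorphicity says that the two edges
   of a face meeting at a corner have the same projection: x + t y (north-east),
   x - t y (north-west), t x + y (south-east), - t x + y (south-west).  Two such
   projections determine the value at an edge, so a row determines, together with
   the lateral boundary conditions, the vertical edges above it and then the next
   row; hence the s-holomorphic extensions to the box are exactly the orbits of
   the row step, which is the propagator P.  The boundary condition on the top
   side says that P^N (u + v) is real, i.e. P_ImRe u + P_ImIm v = 0.

   P_ImIm is injective by an energy argument: over the edges e of one face, the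
   sum of Re (F(e)^2 tau_cw(e)) is nonpositive, and the interior edges cancel in
   the sum over all faces.  If F is parallel to tau_cw^(-1/2) on the whole
   boundary, the boundary terms are |F(e)|^2, so F vanishes there. *)
Require Import Defs.
From HB Require Import structures.
From mathcomp Require Import all_boot all_order all_algebra.
From mathcomp Require Import all_classical all_reals all_analysis.
From mathcomp Require Import complex ring lra.

Set Implicit Arguments.
Unset Strict Implicit.
Unset Printing Implicit Defensive.

Import Order.TTheory GRing.Theory Num.Theory.

Local Open Scope ring_scope.
Local Open Scope complex_scope.

Lemma complex_eqP (R : realType) (z w : R[i]) :
  complex.Re z = complex.Re w -> complex.Im z = complex.Im w -> z = w.
Proof. by case: z w => [x y] [x' y'] /= -> ->. Qed.

(** * The constant tan(pi/8) and the four corner equations as real projections *)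

Section Slope.
Variable R : realType.
Local Notation c := (cos (pi / 4) : R).

Lemma cos_pi4_sqr : c ^+ 2 = 2^-1.
Proof.
have := @cos_mulr2n R (pi / 4).
have -> : (pi / 4 *+ 2 : R) = pi / 2 by field.
by rewrite cos_pihalf -mulr_natr => h; lra.
Qed.

Lemma cos_pi4_gt0 : 0 < c.
Proof. by apply: cos_gt0_pihalf; have := pi_gt0 R; lra. Qed.

Lemma sin_pi4 : sin (pi / 4) = c.
Proof.
have s0 : 0 < sin (pi / 4 : R) by apply: sin_gt0_pi; have := pi_gt0 R; lra.
apply: (@pexpIrn _ 2) => //; rewrite ?nnegrE ?ltW ?cos_pi4_gt0 //.
by have := cos2Dsin2 (pi / 4 : R); rewrite cos_pi4_sqr; lra.
Qed.

(* This is [tan (pi / 8)]: the corner at the north-east of a face sees the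
   projection of F on the line at angle [pi / 8]. *)
Definition slope : R := 2 * c - 1.
Local Notation t := slope.

Lemma slope_gt0 : 0 < t.
Proof. by have := cos_pi4_sqr; have := cos_pi4_gt0; rewrite /slope; nra. Qed.

(** The double-angle formula tan(pi/4) = 1; it makes [t + 2] the inverse of [t]. *)
Lemma slope_sqr : t ^+ 2 = 1 - 2 * t.
Proof. by have := cos_pi4_sqr; rewrite /slope; lra. Qed.

Lemma lambda1E : lambda R = c +i* c.
Proof. by rewrite /lambda sin_pi4. Qed.

Lemma lambdaVE : (lambda R)^-1 = c -i* c.
Proof.
have h := cos_pi4_sqr; apply: GRing.mulr1_eq.
by rewrite lambda1E; apply: complex_eqP => /=; lra.
Qed.

Lemma lambda3E : lambda R ^+ 3 = (- c) +i* c.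
Proof.
have h := cos_pi4_sqr.
have -> : lambda R ^+ 3 = 'i%C * lambda R.
  by rewrite exprSr lambda1E; congr (_ * _); apply: complex_eqP => /=; lra.
by rewrite lambda1E; apply: complex_eqP => /=; ring.
Qed.

Lemma lambdaV3E : lambda R ^- 3 = (- c) -i* c.
Proof.
have h := cos_pi4_sqr; apply: GRing.mulr1_eq.
by rewrite lambda3E; apply: complex_eqP => /=; lra.
Qed.

(** The map sending z to [z + mu * z^*] is real-linear and takes 1 and i to [1 + mu] and
    ['i * (1 - mu)]. If both lie on the real line through [nu], the complex equation carries only
    one real equation. *)
Lemma corner_projection (mu nu : R[i]) (p q : R) : nu != 0 ->
    1 + mu = nu * p%:C -> 'i%C * (1 - mu) = nu * q%:C ->
  forall z w : R[i], z + mu * z^* = w + mu * w^* <->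
    p * complex.Re z + q * complex.Im z = p * complex.Re w + q * complex.Im w.
Proof.
move=> nu0 hp hq.
have E (z : R[i]) :
    z + mu * z^* = nu * (p * complex.Re z + q * complex.Im z)%:C.
  rewrite rmorphD !rmorphM /= mulrDr !mulrA -hp -hq.
  case: z mu {nu0 hp hq} => [x y] [m n].
  by apply: complex_eqP => /=; ring.
move=> z w; rewrite !E; split=> [/(mulfI nu0)/complexI //|-> //].
Qed.

Lemma cornerNE (z w : R[i]) : z + lambda R * z^* = w + lambda R * w^* <->
  complex.Re z + t * complex.Im z = complex.Re w + t * complex.Im w.
Proof.
have h := cos_pi4_sqr; have c0 := cos_pi4_gt0.
(* Here [nu] is [1 + mu], which normalises [p] to 1; at the two southern corners it is
   ['i * (1 - mu)], which normalises [q] to 1. *)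
have := @corner_projection (lambda R) ((1 + c) +i* c) 1 t _ _ _ z w.
rewrite ?mulNr !mul1r; apply; rewrite ?lambda1E.
- by rewrite eq_complex /= negb_and; apply/orP; right; rewrite gt_eqF.
- by apply: complex_eqP => /=; ring.
- by apply: complex_eqP => /=; rewrite /slope; lra.
Qed.

Lemma cornerNW (z w : R[i]) :
  z + (lambda R)^-1 * z^* = w + (lambda R)^-1 * w^* <->
  complex.Re z - t * complex.Im z =
  complex.Re w - t * complex.Im w.
Proof.
have h := cos_pi4_sqr; have c0 := cos_pi4_gt0.
have := @corner_projection (lambda R)^-1 ((1 + c) -i* c) 1 (- t) _ _ _ z w.
rewrite ?mulNr !mul1r; apply; rewrite ?lambdaVE.
- by rewrite eq_complex /= negb_and; apply/orP; right; rewrite oppr_eq0 gt_eqF.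
- by apply: complex_eqP => /=; ring.
- by apply: complex_eqP => /=; rewrite /slope; lra.
Qed.

Lemma cornerSE (z w : R[i]) :
  z + lambda R ^+ 3 * z^* = w + lambda R ^+ 3 * w^* <->
  t * complex.Re z + complex.Im z = t * complex.Re w + complex.Im w.
Proof.
have h := cos_pi4_sqr; have c0 := cos_pi4_gt0.
have := @corner_projection (lambda R ^+ 3) (c +i* (1 + c)) t 1 _ _ _ z w.
rewrite ?mulNr !mul1r; apply; rewrite ?lambda3E.
- by rewrite eq_complex /= negb_and; apply/orP; left; rewrite gt_eqF.
- by apply: complex_eqP => /=; rewrite /slope; lra.
- by apply: complex_eqP => /=; ring.
Qed.

Lemma cornerSW (z w : R[i]) :
  z + lambda R ^- 3 * z^* = w + lambda R ^- 3 * w^* <->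
  - t * complex.Re z + complex.Im z =
  - t * complex.Re w + complex.Im w.
Proof.
have h := cos_pi4_sqr; have c0 := cos_pi4_gt0.
have := @corner_projection (lambda R ^- 3) ((- c) +i* (1 + c)) (- t) 1
  _ _ _ z w.
rewrite ?mulNr !mul1r; apply; rewrite ?lambdaV3E.
- by rewrite eq_complex /= negb_and; apply/orP; left; rewrite oppr_eq0 gt_eqF.
- by apply: complex_eqP => /=; rewrite /slope; lra.
- by apply: complex_eqP => /=; ring.
Qed.

End Slope.

(** * The edges of a face and s-holomorphicity indexed by faces *)

Section Face.
Variables (a b : int) (n : nat) (R : realType).
Implicit Types (k : 'I_(ncol a b)) (y : 'I_n).

(** [lift ord0] is the shift by one into the larger ordinal, [lift ord_max] the value-preserving
    inclusion. *)
Definition edgeE k y : edge a b n := inr (lift ord0 k, y).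
Definition edgeN k y : edge a b n := inl (k, lift ord0 y).
Definition edgeW k y : edge a b n := inr (lift ord_max k, y).
Definition edgeS k y : edge a b n := inl (k, lift ord_max y).

Lemma half_neq (i j : nat) : (i%:R + 2^-1 == j%:R :> R) = false.
Proof.
apply/negP => /eqP h; have : (i.*2.+1)%:R = (j.*2)%:R :> R.
  by rewrite -natr1 -!muln2 !natrM; lra.
by move/eqP; rewrite eqr_nat => /eqP /(congr1 odd); rewrite /= !odd_double.
Qed.

(** [s_holomorphic] names edges through their midpoints; injectivity turns them into the four
    explicit edges. A half-integer offset, by parity, separates horizontal edges from vertical
    ones. *)
Lemma midpoint_inj : injective (@midpoint a b n R).
Proof.
have dbl (i j : nat) (s : R) : i%:R + s = j%:R + s -> i = j.
  by move/addIr/eqP; rewrite eqr_nat => /eqP.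
move=> [[k y]|[k y]] [[k' y']|[k' y']] /= [].
- rewrite -!addrA => /addrI /dbl /val_inj -> /eqP.
  by rewrite eqr_nat => /eqP /val_inj ->.
- by rewrite -!addrA => /addrI /eqP; rewrite half_neq.
- by rewrite -!addrA => /addrI /eqP; rewrite eq_sym half_neq.
- move=> /addrI /eqP; rewrite eqr_nat => /eqP /val_inj ->.
  by move=> /dbl /val_inj ->.
Qed.

Lemma inv2_complex : 2^-1 = 2^-1 +i* 0 :> R[i].
Proof. by apply: (mulfI (_ : 2 != 0)) => //; rewrite mulfV //;
  apply: complex_eqP => /=; field. Qed.

Lemma s_holomorphicP (h : {ffun edge a b n -> R[i]}) :
  s_holomorphic h <-> forall k y,
    [/\ h (edgeN k y) + lambda R * (h (edgeN k y))^* =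
          h (edgeE k y) + lambda R * (h (edgeE k y))^*,
        h (edgeN k y) + (lambda R)^-1 * (h (edgeN k y))^* =
          h (edgeW k y) + (lambda R)^-1 * (h (edgeW k y))^*,
        h (edgeS k y) + lambda R ^+ 3 * (h (edgeS k y))^* =
          h (edgeE k y) + lambda R ^+ 3 * (h (edgeE k y))^* &
        h (edgeS k y) + lambda R ^- 3 * (h (edgeS k y))^* =
          h (edgeW k y) + lambda R ^- 3 * (h (edgeW k y))^*].
Proof.
have mE k y : midpoint R (edgeE k y) = face_center R (k, y) + 2^-1.
  rewrite inv2_complex; apply: complex_eqP => /=; last by rewrite addr0.
  by rewrite /bump /= add1n -natr1; field.
have mN k y : midpoint R (edgeN k y) = face_center R (k, y) + 'i%C / 2.
  rewrite inv2_complex; apply: complex_eqP => /=; first by field.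
  by rewrite /bump /= add1n -natr1; field.
have mW k y : midpoint R (edgeW k y) = face_center R (k, y) - 2^-1.
  rewrite inv2_complex; apply: complex_eqP => /=; last by rewrite subr0.
  by rewrite /bump leqNgt ltn_ord add0n; field.
have mS k y : midpoint R (edgeS k y) = face_center R (k, y) - 'i%C / 2.
  rewrite inv2_complex; apply: complex_eqP => /=; first by field.
  by rewrite /bump leqNgt ltn_ord add0n; field.
split=> [H k y|H [k y] E N W S].
  by apply: (H (k, y)).
rewrite -mE -mN -mW -mS => /midpoint_inj -> /midpoint_inj -> /midpoint_inj ->.
by move=> /midpoint_inj ->; apply: H.
Qed.

End Face.

Section FaceReal.
Variables (a b : int) (n : nat) (R : realType).
Local Notation t := (slope R).

Lemma s_holomorphic_cornersP (h : {ffun edge a b n -> R[i]}) :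
  s_holomorphic h <-> forall (k : 'I_(ncol a b)) (y : 'I_n),
    let: (zE, zN, zW, zS) :=
      (h (edgeE k y), h (edgeN k y), h (edgeW k y), h (edgeS k y)) in
    [/\ complex.Re zN + t * complex.Im zN = complex.Re zE + t * complex.Im zE,
        complex.Re zN - t * complex.Im zN = complex.Re zW - t * complex.Im zW,
        t * complex.Re zS + complex.Im zS = t * complex.Re zE + complex.Im zE &
        - t * complex.Re zS + complex.Im zS =
          - t * complex.Re zW + complex.Im zW].
Proof.
rewrite s_holomorphicP; split=> H k y; move: (H k y).
  by move=> [/cornerNE ? /cornerNW ? /cornerSE ? /cornerSW ?].
by move=> [*]; split;
  [apply/cornerNE|apply/cornerNW|apply/cornerSE|apply/cornerSW].
Qed.

End FaceReal.

(** * Boundary conditions as real linear equations *)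

Section ParallelInvsqrt.
Variable R : realType.
Implicit Types z tau s : R[i].

(** Two square roots differ by a sign, absorbed by the real factor, so any convenient root may be
    fixed. *)
Lemma parallel_invsqrtP s tau z : s ^+ 2 = tau^-1 ->
  parallel_invsqrt z tau <-> exists r : R, z = r%:C * s.
Proof.
move=> hs; split=> [[s' [r [hs' ->]]]|[r ->]]; last by exists s, r.
have /eqP : s' ^+ 2 = s ^+ 2 by rewrite hs.
rewrite eqf_sqr => /orP[] /eqP ->; first by exists r.
by exists (- r); rewrite rmorphN mulrN mulNr.
Qed.

Lemma parallel_invsqrt1 z : parallel_invsqrt z 1 <-> complex.Im z = 0.
Proof.
rewrite (@parallel_invsqrtP 1) ?invr1 ?expr1n //.
split=> [[r ->]|h]; first by rewrite mulr1.
by exists (complex.Re z); rewrite mulr1; apply: complex_eqP.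
Qed.

Lemma parallel_invsqrtN1 z : parallel_invsqrt z (- 1) <-> complex.Re z = 0.
Proof.
rewrite (@parallel_invsqrtP 'i%C) ?invrN1 ?sqr_i //.
split=> [[r ->]|h] /=; first by ring.
by exists (complex.Im z); apply: complex_eqP => /=; rewrite ?h; ring.
Qed.

Lemma parallel_invsqrtNi z :
  parallel_invsqrt z (- 'i%C) <-> complex.Re z = complex.Im z.
Proof.
have c0 := cos_pi4_gt0 R; have h2 := cos_pi4_sqr R.
rewrite (@parallel_invsqrtP (lambda R)); last first.
  by apply/esym/GRing.mulr1_eq; rewrite lambda1E; apply: complex_eqP => /=; lra.
rewrite lambda1E; split=> [[r ->]|h] /=; first by ring.
exists (complex.Re z / cos (pi / 4)).
by apply: complex_eqP => /=; rewrite -?h; field; lra.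
Qed.

Lemma parallel_invsqrti z :
  parallel_invsqrt z 'i%C <-> complex.Re z = - complex.Im z.
Proof.
have c0 := cos_pi4_gt0 R; have h2 := cos_pi4_sqr R.
rewrite (@parallel_invsqrtP (lambda R)^-1); last first.
  apply/esym/GRing.mulr1_eq; rewrite lambdaVE.
  by apply: complex_eqP => /=; lra.
rewrite lambdaVE; split=> [[r ->]|h] /=; first by ring.
exists (- complex.Im z / cos (pi / 4)).
by apply: complex_eqP => /=; rewrite ?h; field; lra.
Qed.

End ParallelInvsqrt.

(** * The row step: existence, uniqueness and real linearity *)

Section RowStep.
Variables (R : realType) (m : nat).
Implicit Types (f g : 'cV[R[i]]_m) (x : 'I_m.+1) (k : 'I_m).
Local Notation t := (slope R).

(* An interior vertical edge is determined by its south-east projection, shared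
   with the edge of [f] on its left, and its south-west one, shared with the
   edge of [f] on its right.  On the two sides, the boundary condition replaces
   the missing projection. *)
Definition vertical_row f x : R[i] :=
  match unlift ord0 x, unlift ord_max x with
  | Some j, Some k =>
      let A := t * complex.Re (f j 0) + complex.Im (f j 0) in
      let B := - t * complex.Re (f k 0) + complex.Im (f k 0) in
      ((A - B) / (2 * t)) +i* ((A + B) / 2)
  | Some j, None =>
      let A := (t * complex.Re (f j 0) + complex.Im (f j 0)) / (1 + t) in
      A +i* A
  | None, Some k =>
      let B := (- t * complex.Re (f k 0) + complex.Im (f k 0)) / (1 + t) in
      (- B) +i* B
  (* This occurs only for [m = 0], where both side conditions bear on the same edge and force 0. *)
  | None, None => 0
  end.

(** [A] and [B] are the north-east and north-west projections, inherited from the vertical edges to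
    the right and left; solving for the two coordinates gives the value. *)
Definition next_row f : 'cV[R[i]]_m :=
  \col_k
    let E := vertical_row f (lift ord0 k) in
    let W := vertical_row f (lift ord_max k) in
    let A := complex.Re E + t * complex.Im E in
    let B := complex.Re W - t * complex.Im W in
    ((A + B) / 2) +i* ((A - B) / (2 * t)).

Lemma vertical_row_SE f k : let E := vertical_row f (lift ord0 k) in
  t * complex.Re (f k 0) + complex.Im (f k 0) = t * complex.Re E + complex.Im E.
Proof.
have t0 := slope_gt0 R.
by rewrite /vertical_row liftK; case: unliftP => [j _|_] /=; field; lra.
Qed.

Lemma vertical_row_SW f k : let W := vertical_row f (lift ord_max k) in
  - t * complex.Re (f k 0) + complex.Im (f k 0) =
  - t * complex.Re W + complex.Im W.
Proof.
have t0 := slope_gt0 R.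
by rewrite /vertical_row liftK; case: unliftP => [j _|_] /=; field; lra.
Qed.

Lemma vertical_row_left f : let V := vertical_row f ord0 in
  complex.Re V = - complex.Im V.
Proof.
rewrite /vertical_row unlift_none.
by case: unlift => [j|] //=; rewrite oppr0.
Qed.

Lemma vertical_row_right f : let V := vertical_row f ord_max in
  complex.Re V = complex.Im V.
Proof. by rewrite /vertical_row unlift_none; case: unlift. Qed.

Lemma vertical_row_unique f (V : 'I_m.+1 -> R[i]) :
    (forall k, let E := V (lift ord0 k) in
       t * complex.Re (f k 0) + complex.Im (f k 0) =
       t * complex.Re E + complex.Im E) ->
    (forall k, let W := V (lift ord_max k) in
       - t * complex.Re (f k 0) + complex.Im (f k 0) =
       - t * complex.Re W + complex.Im W) ->
    complex.Re (V ord0) = - complex.Im (V ord0) ->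
    complex.Re (V ord_max) = complex.Im (V ord_max) ->
  V =1 vertical_row f.
Proof.
move=> hE hW hl hr x; have t0 := slope_gt0 R; rewrite /vertical_row.
case: unliftP => [j xj|x0]; case: unliftP => [k xk|xm] /=.
- have := hE j; have := hW k; rewrite -xj -xk /= => -> ->.
  by apply: complex_eqP => /=; field; lra.
- have := hE j; rewrite -xj /= => ->; move: hr; rewrite -xm => hr.
  by apply: complex_eqP => /=; rewrite hr; field; lra.
- have := hW k; rewrite -xk /= => ->; move: hl; rewrite -x0 => hl.
  by apply: complex_eqP => /=; rewrite hl; field; lra.
- move: hl hr; rewrite -x0 -xm => hl hr.
  by apply: complex_eqP => /=; lra.
Qed.

Lemma next_row_NE f k : let E := vertical_row f (lift ord0 k) in
  complex.Re (next_row f k 0) + t * complex.Im (next_row f k 0) =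
  complex.Re E + t * complex.Im E.
Proof. by have t0 := slope_gt0 R; rewrite mxE /=; field; lra. Qed.

Lemma next_row_NW f k : let W := vertical_row f (lift ord_max k) in
  complex.Re (next_row f k 0) - t * complex.Im (next_row f k 0) =
  complex.Re W - t * complex.Im W.
Proof. by have t0 := slope_gt0 R; rewrite mxE /=; field; lra. Qed.

Lemma next_row_unique f (z : R[i]) k :
    (let E := vertical_row f (lift ord0 k) in
     complex.Re z + t * complex.Im z = complex.Re E + t * complex.Im E) ->
    (let W := vertical_row f (lift ord_max k) in
     complex.Re z - t * complex.Im z = complex.Re W - t * complex.Im W) ->
  z = next_row f k 0.
Proof.
have t0 := slope_gt0 R; move=> /= hE hW; rewrite mxE /= -hE -hW.
by apply: complex_eqP => /=; field; lra.
Qed.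

Definition real_linear p (T : 'cV[R[i]]_m -> 'cV[R[i]]_p) :=
  forall (r : R) f g, T (r%:C *: f + g) = r%:C *: T f + T g.

Lemma vertical_row_linear (r : R) f g x :
  vertical_row (r%:C *: f + g) x =
  r%:C * vertical_row f x + vertical_row g x.
Proof.
have t0 := slope_gt0 R; rewrite /vertical_row.
case: unlift => [j|]; case: unlift => [k|]; rewrite ?mulr0 ?addr0 // !mxE;
  case: (f _ 0) => [? ?]; case: (g _ 0) => [? ?];
  try (case: (f _ 0) => [? ?]; case: (g _ 0) => [? ?]);
  by apply: complex_eqP => /=; field; lra.
Qed.

Lemma next_row_linear : real_linear next_row.
Proof.
move=> r f g; apply/colP => k; rewrite !mxE !vertical_row_linear.
have t0 := slope_gt0 R.
case: (vertical_row f _) => ? ?; case: (vertical_row g _) => ? ?.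
case: (vertical_row f _) => ? ?; case: (vertical_row g _) => ? ?.
by apply: complex_eqP => /=; field; lra.
Qed.

End RowStep.

(** * Extensions to the box as orbits of the row step *)

Section BoxExtension.
Variables (R : realType) (a b : int) (n : nat).
Implicit Types (f : 'cV[R[i]]_(ncol a b)) (h : {ffun edge a b n -> R[i]}).

Definition lateral_condition h := forall y : 'I_n,
  complex.Re (h (inr (ord0, y))) = - complex.Im (h (inr (ord0, y))) /\
  complex.Re (h (inr (ord_max, y))) = complex.Im (h (inr (ord_max, y))).

Lemma lateral_conditionP h : (0 < ncol a b)%N ->
  lateral_condition h <-> forall e, boundary e -> ~~ horizontal e ->
    parallel_invsqrt (h e) (tau_cw R e).
Proof.
move=> m0; split=> [H [//|[x y]] /= /orP[] /eqP -> _|H y].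
- by rewrite eqxx; apply/parallel_invsqrti; case: (H y).
- by rewrite -val_eqE /= gtn_eqF //; apply/parallel_invsqrtNi; case: (H y).
have := H (inr (ord_max, y)); have := H (inr (ord0, y)).
rewrite /= !eqxx orbT -val_eqE /= gtn_eqF //.
by move=> /(_ isT isT) /parallel_invsqrti ? /(_ isT isT) /parallel_invsqrtNi ?.
Qed.

Definition box_extension f : {ffun edge a b n -> R[i]} :=
  [ffun e : edge a b n => match e with
   | inl (k, y) => iter y (@next_row R _) f k 0
   | inr (x, y) => vertical_row (iter y (@next_row R _) f) x
   end].

Lemma box_extension_s_holomorphic f : s_holomorphic (box_extension f).
Proof.
apply/s_holomorphic_cornersP => k y.
rewrite !ffunE /edgeE /edgeN /edgeW /edgeS lift_max lift0 iterS.
split; [exact: next_row_NE|exact: next_row_NW| |].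
  exact: vertical_row_SE.
exact: vertical_row_SW.
Qed.

Lemma box_extension_lateral f : lateral_condition (box_extension f).
Proof.
by move=> y; rewrite !ffunE; split;
  [exact: vertical_row_left|exact: vertical_row_right].
Qed.

(** Induction on height: a horizontal row fixes the vertical edges above it ([ver]), and these fix
    the next horizontal row ([hor]). *)
Lemma box_extension_unique f h : s_holomorphic h -> lateral_condition h ->
  (forall k, h (bottom_edge n k) = f k 0) -> h = box_extension f.
Proof.
move=> /s_holomorphic_cornersP hol lat bot.
pose row j : 'cV[R[i]]_(ncol a b) := iter j (@next_row R _) f.
have ver (y : 'I_n) : (forall k, h (edgeS k y) = row y k 0) ->
    forall x, h (inr (x, y)) = vertical_row (row y) x.
  move=> hy; apply: vertical_row_unique => [k|k||].
  - by rewrite -hy; case: (hol k y).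
  - by rewrite -hy; case: (hol k y).
  - by case: (lat y).
  - by case: (lat y).
have hor j (hj : (j < n.+1)%N) k : h (inl (k, Ordinal hj)) = row j k 0.
  elim: j hj k => [|j IH] hj k.
    by rewrite -bot; congr (h (inl (k, _))); apply: val_inj.
  pose y : 'I_n := Ordinal (hj : (j < n)%N).
  have S' k' : h (edgeS k' y) = row y k' 0.
    rewrite -(IH (ltnW hj)); congr (h (inl (k', _))); apply: val_inj.
    exact: lift_max.
  have -> : h (inl (k, Ordinal hj)) = h (edgeN k y).
    by congr (h (inl (k, _))); apply: val_inj.
  apply: next_row_unique => /=; rewrite -(ver y S').
  - by case: (hol k y).
  - by case: (hol k y).
apply/ffunP => -[[k [y hy]]|[x y]]; rewrite ffunE; first exact: hor.
apply: ver => k; rewrite /edgeS.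
have -> : lift ord_max y =
    Ordinal (ltnW (ltn_ord y : (y < n)%N) : (y < n.+1)%N).
  by apply: val_inj; exact: lift_max.
exact: hor.
Qed.

End BoxExtension.

(** * The propagator and the graph of the RPS operator in terms of the row step *)

Section Propagator.
Variables (R : realType) (a b : int).
Implicit Types f u v : 'cV[R[i]]_(ncol a b).

Lemma propagatorE : (0 < ncol a b)%N -> @propagator R a b =1 @next_row R _.
Proof.
move=> m0 f; rewrite /propagator.
rewrite (@xget_unique _ _ _ (box_extension 1 f)).
- by apply/colP => k; rewrite mxE ffunE.
- split; [exact: box_extension_s_holomorphic|by move=> k; rewrite ffunE|].
  by apply/lateral_conditionP => //; exact: box_extension_lateral.
- move=> h [hol bot /(lateral_conditionP _ m0) lat].
  exact: box_extension_unique.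
Qed.

Lemma iter_propagatorE n : (0 < ncol a b)%N ->
  iter n (@propagator R a b) =1 iter n (@next_row R _).
Proof. by move=> m0 f; elim: n => //= n ->; rewrite propagatorE. Qed.

Lemma space_RP n f :
  space_R n f <-> forall k, complex.Im (f k 0) = 0.
Proof.
split=> H k; have := H k; rewrite /tau_ccw /= ?opprK.
  by move/parallel_invsqrt1.
by move=> h; apply/parallel_invsqrt1.
Qed.

Lemma space_IP n f :
  space_I n f <-> forall k, complex.Re (f k 0) = 0.
Proof.
split=> H k; have := H k; rewrite /=.
  by move/parallel_invsqrtN1.
by move=> h; apply/parallel_invsqrtN1.
Qed.

(** The only candidate for [h] is the orbit of [u + v], so what remains is the condition on the top
    side, where [tau_cw] is 1 and values must be real. *)
Lemma RPS_graphP n u v : (0 < ncol a b)%N -> (0 < n)%N ->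
  RPS_graph n u v <-> (forall k, complex.Re (v k 0) = 0) /\
    (forall k, complex.Im (iter n (@next_row R _) (u + v) k 0) = 0).
Proof.
move=> m0 n0; rewrite /RPS_graph /= space_IP.
have top0 : (ord_max == ord0 :> 'I_n.+1) = false.
  by rewrite -val_eqE /= gtn_eqF.
split=> [[Rv [h [hol bot bnd]]]|[Rv top]]; split=> //.
  have lat : lateral_condition h.
    apply/lateral_conditionP => // -[//|[x y]] bxy _.
    exact: (bnd (inr (x, y))).
  move=> k; have := bnd (top_edge n k).
  rewrite (box_extension_unique hol lat bot) ffunE /= eqxx orbT top0.
  by move=> /(_ isT isT) /parallel_invsqrt1.
exists (box_extension n (u + v)).
split; [exact: box_extension_s_holomorphic|by move=> k; rewrite ffunE|].
move=> [[k y]|[x y]] be; last first.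
  move=> _; apply: (lateral_conditionP _ m0).1 => //.
  exact: box_extension_lateral.
move: be => /= /orP[/eqP ->//|/eqP ->] _; rewrite top0 ffunE.
exact/parallel_invsqrt1.
Qed.

End Propagator.

(** * The energy inequality, on a face and then on the box *)

Section Energy.
Variable R : realType.
Local Notation t := (slope R).

(** Along a row or column of faces, the contributions of interior edges cancel. *)
Lemma telescope_ord (V : zmodType) n (G : 'I_n.+1 -> V) :
  \sum_(i < n) (G (lift ord0 i) - G (lift ord_max i)) = G ord_max - G ord0.
Proof.
have E : \sum_(i < n.+1) G i = \sum_(i < n) G (lift ord_max i) + G ord_max.
  rewrite big_ord_recr; congr (_ + _); apply: eq_bigr => i _; congr (G _).
  by apply: val_inj; rewrite /= -[LHS](lift_max i).
rewrite big_ord_recl /= addrC in E.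
by rewrite sumrB -[X in X - _](addrK (G ord0)) E addrC !addrA addNr add0r.
Qed.

(* The left-hand side is [\sum_e Re (F(e) ^+ 2 * tau_cw e)] over the four edges
   of a face: up to a negative factor, it is the sum of the squares
   [((1 + t) * p2 + p1 - p3) ^+ 2] and [((1 + t) * p4 - p1 - p3) ^+ 2] where
   p1, p2, p3, p4 are the south-west, north-west, north-east and south-east
   projections. *)
Lemma face_energy_le0 (xE yE xN yN xW yW xS yS : R) :
    xN + t * yN = xE + t * yE -> xN - t * yN = xW - t * yW ->
    t * xS + yS = t * xE + yE -> - t * xS + yS = - t * xW + yW ->
  (xN ^+ 2 - yN ^+ 2 - (xS ^+ 2 - yS ^+ 2)) + (2 * xE * yE - 2 * xW * yW) <= 0.
Proof.
move=> h1 h2 h3 h4; have t0 := slope_gt0 R; have tt := slope_sqr R.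
pose p1 := - t * xW + yW; pose p2 := xW - t * yW.
pose p3 := xE + t * yE; pose p4 := t * xE + yE.
(* Multiplying by [t + 2] instead of dividing by [t] keeps everything polynomial in [t], to be
   reduced with [tt]. *)
have inv_t w : t * w * (t + 2) = w by rewrite mulrAC mulrDr -expr2 tt; ring.
have -> : xN = (p3 + p2) / 2 by rewrite /p3 /p2; lra.
have -> : yN = (p3 - p2) * (t + 2) / 2.
  by rewrite -[LHS]inv_t /p3 /p2 -h1 -h2; field.
have -> : yS = (p4 + p1) / 2 by rewrite /p4 /p1; lra.
have -> : xS = (p4 - p1) * (t + 2) / 2.
  by rewrite -[LHS]inv_t /p4 /p1 -h3 -h4; field.
set Q := (X in X <= 0).
have -> : Q = - ((t + 2) / 2 * (((1 + t) * p2 + p1 - p3) ^+ 2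
                              + ((1 + t) * p4 - p1 - p3) ^+ 2)).
  by rewrite /Q /p1 /p2 /p3 /p4; field: tt.
by rewrite oppr_le0 mulr_ge0 ?addr_ge0 ?sqr_ge0 //; lra.
Qed.

End Energy.

Section BoxEnergy.
Variables (R : realType) (a b : int) (n : nat).

Lemma bottom_eq0 (h : {ffun edge a b n -> R[i]}) :
    s_holomorphic h -> lateral_condition h ->
    (forall k, complex.Re (h (bottom_edge n k)) = 0) ->
    (forall k, complex.Im (h (top_edge n k)) = 0) ->
  forall k, h (bottom_edge n k) = 0.
Proof.
move=> /s_holomorphic_cornersP hol lat bot top.
(* [g] and [d] are the real and imaginary parts of the square of [h]; [B] and [L] collect the
   horizontal and the lateral boundary terms. *)
pose g e := complex.Re (h e) ^+ 2 - complex.Im (h e) ^+ 2.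
pose d e := 2 * complex.Re (h e) * complex.Im (h e).
pose B := \sum_k (g (top_edge n k) - g (bottom_edge n k)).
pose L := \sum_(y < n) (d (inr (ord_max, y)) - d (inr (ord0, y))).
have BL : B + L <= 0.
  rewrite /B /L; under eq_bigr => k _ do
    rewrite -(telescope_ord (fun y => g (inl (k, y)))).
  under [X in _ + X]eq_bigr => y _ do
    rewrite -(telescope_ord (fun x => d (inr (x, y)))).
  rewrite [X in _ + X]exchange_big /= -big_split /= sumr_le0 // => k _.
  rewrite -big_split /= sumr_le0 // => y _.
  by case: (hol k y) => *; apply: face_energy_le0.
have L0 : 0 <= L.
  rewrite sumr_ge0 // => y _; rewrite /d; case: (lat y) => -> ->.
  by rewrite !mulrN !mulNr opprK -!mulrA addr_ge0 // mulr_ge0 // -expr2 sqr_ge0.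
have BE k : g (top_edge n k) - g (bottom_edge n k) =
    complex.Re (h (top_edge n k)) ^+ 2 + complex.Im (h (bottom_edge n k)) ^+ 2.
  by rewrite /g top bot; ring.
have Bk k : 0 <= g (top_edge n k) - g (bottom_edge n k).
  by rewrite BE addr_ge0 ?sqr_ge0.
(* [B] is a sum of nonnegative terms, while [B + L <= 0] and [0 <= L]; hence each term vanishes. *)
have B0 : B = 0.
  by apply/eqP; rewrite eq_le sumr_ge0 // andbT; lra.
move=> k; apply: complex_eqP; first exact: bot.
have := psumr_eq0P (fun k _ => Bk k) B0 (i := k) isT; rewrite BE => /eqP.
by rewrite paddr_eq0 ?sqr_ge0 // => /andP[_]; rewrite sqrf_eq0 => /eqP.
Qed.

End BoxEnergy.

(** * Real matrices of real-linear maps on complex columns *)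

Section RealMatrix.
Variables (R : realType) (m : nat).
Implicit Types (f g : 'cV[R[i]]_m) (w : 'cV[R]_(m + m)).

Lemma to_realK : cancel (@to_real R m) (@of_real R m).
Proof.
move=> f; apply/colP => k; rewrite mxE col_mxKu col_mxKd !mxE.
exact: complex_eqP.
Qed.

Lemma of_realK : cancel (@of_real R m) (@to_real R m).
Proof.
move=> w; rewrite /to_real -[RHS]vsubmxK.
by congr col_mx; apply/colP => k; rewrite !mxE.
Qed.

Lemma to_real_linear (r : R) f g :
  to_real (r%:C *: f + g) = r *: to_real f + to_real g.
Proof.
rewrite /to_real scale_col_mx add_col_mx.
by congr col_mx; apply/colP => k; rewrite !mxE; case: (f k 0) => ? ?;
  case: (g k 0) => ? ? /=; ring.
Qed.

Lemma of_real_linear (r : R) w w' :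
  of_real (r *: w + w') = r%:C *: of_real w + of_real w'.
Proof. by apply: (can_inj to_realK); rewrite to_real_linear !of_realK. Qed.

Lemma real_mxP (T : 'cV[R[i]]_m -> 'cV[R[i]]_m) f : real_linear T ->
  to_real (T f) = real_mx T *m to_real f.
Proof.
(* Conjugation yields a linear map over [R], which can be expanded on the canonical basis. *)
move=> hT; pose T' w := to_real (T (of_real w)).
have lT : linear T'.
  by move=> r w w'; rewrite /T' of_real_linear hT to_real_linear.
pose L : {linear 'cV[R]_(m + m) -> 'cV[R]_(m + m)} :=
  HB.pack T' (GRing.isLinear.Build _ _ _ _ T' lT).
rewrite -[in LHS](to_realK f) -/(T' _) -[T' _]/(L _).
move: (to_real f) => w.
rewrite [in LHS](matrix_sum_delta w) linear_sum /=.
apply/colP => i; rewrite summxE mxE; apply: eq_bigr => j _.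
by rewrite big_ord1 -[T' _]/(L _) linearZ /= !mxE mulrC.
Qed.

Lemma iter_real_linear n (T : 'cV[R[i]]_m -> 'cV[R[i]]_m) :
  real_linear T -> real_linear (iter n T).
Proof. by move=> hT r f g; elim: n => //= n ->; rewrite hT. Qed.

End RealMatrix.

(** * Invertibility and the block formula *)

Lemma unitmx_col (F : fieldType) n (A : 'M[F]_n) :
  (forall v : 'cV_n, A *m v = 0 -> v = 0) -> A \in unitmx.
Proof.
move=> inj; rewrite -unitmx_tr -row_free_unit; apply: inj_row_free => v.
move=> /(congr1 trmx); rewrite trmx_mul trmxK trmx0 => /inj.
by move/(congr1 trmx); rewrite trmxK trmx0.
Qed.

Theorem lemma31 (R : realType) (a b : int) (N : nat)
    (hab : a < b) (hN : (1 <= N)%N) :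
  let PN : 'cV[R[i]]_(ncol a b) -> 'cV[R[i]]_(ncol a b) :=
    iter N (@propagator R a b) in
  let PReRe := ulsubmx (real_mx PN) in
  let PReIm := ursubmx (real_mx PN) in
  let PImRe := dlsubmx (real_mx PN) in
  let PImIm := drsubmx (real_mx PN) in
  [/\ (forall f : 'cV[R[i]]_(ncol a b),
         to_real (PN f) = block_mx PReRe PReIm PImRe PImIm *m to_real f),
      PImIm \in unitmx &
      forall u : 'cV[R[i]]_(ncol a b), @space_R R a b N u ->
        RPS N u = of_real (col_mx 0 (- (invmx PImIm *m PImRe) *m re_col u))].
Proof.
move=> PN PReRe PReIm PImRe PImIm.
have m0 : (0 < ncol a b)%N by rewrite absz_gt0 subr_eq0 gt_eqF.
have PNE : PN =1 iter N (@next_row R _) by exact: iter_propagatorE.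
have linPN : real_linear PN.
  by move=> r f g; rewrite !PNE; apply/iter_real_linear/next_row_linear.
have blocks f : to_real (PN f) =
    block_mx PReRe PReIm PImRe PImIm *m to_real f.
  by rewrite submxK; apply: real_mxP.
have im_PN f : im_col (PN f) = PImRe *m re_col f + PImIm *m im_col f.
  have := blocks f; rewrite /to_real mul_block_col => /eq_col_mx[_ ->] //.
have im0P f : (forall k, complex.Im (PN f k 0) = 0) <-> im_col (PN f) = 0.
  split=> [H|/colP H k]; first by apply/colP => k; rewrite !mxE.
  by have := H k; rewrite !mxE.
have unitP : PImIm \in unitmx.
  apply: unitmx_col => w Pw0.
  (* A kernel vector [w] gives the purely imaginary bottom row iw, whose box extension has a real
     top row; [bottom_eq0] then makes it vanish. *)
  pose f : 'cV[R[i]]_(ncol a b) := of_real (col_mx 0 w).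
  have [ref imf] : re_col f = 0 /\ im_col f = w.
    by apply: eq_col_mx; rewrite -/(to_real f) of_realK.
  have f0 k : f k 0 = 0.
    have <- : box_extension N f (bottom_edge N k) = f k 0 by rewrite ffunE.
    apply: bottom_eq0 (box_extension_s_holomorphic f)
      (box_extension_lateral f) _ _ _ => {}k; rewrite ffunE /=.
      by have /colP/(_ k) := ref; rewrite !mxE.
    rewrite -PNE; apply: (im0P f).2.
    by rewrite im_PN ref imf mulmx0 add0r.
  by rewrite -imf; apply/colP => k; rewrite mxE f0 mxE.
split=> // u /space_RP uR.
have imu : im_col u = 0 by apply/colP => k; rewrite !mxE.
have graphE v : RPS_graph N u v <->
    re_col v = 0 /\ im_col v = - (invmx PImIm *m PImRe) *m re_col u.
  have imD : re_col v = 0 -> im_col (PN (u + v)) =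
      PImRe *m re_col u + PImIm *m im_col v.
    move=> rev; rewrite im_PN /re_col /im_col !map_mxD -/(re_col u).
    by rewrite -/(re_col v) -/(im_col u) -/(im_col v) rev imu addr0 add0r.
  rewrite RPS_graphP //; split=> [[rv iv]|[rev imv]].
    have rev : re_col v = 0 by apply/colP => k; rewrite !mxE.
    split=> //; have /im0P : forall k, complex.Im (PN (u + v) k 0) = 0.
      by move=> k; rewrite PNE.
    rewrite imD // => /eqP; rewrite addrC addr_eq0 => /eqP E.
    by rewrite -[LHS](mulKmx unitP) E mulmxN mulNmx mulmxA.
  split=> k; first by have /colP/(_ k) := rev; rewrite !mxE.
  rewrite -PNE; apply: (im0P _).2.
  by rewrite imD // imv mulNmx mulmxN -mulmxA mulKVmx // subrr.
(* [graphE] prescribes both parts of [v], so the graph over [u] has a single point, which [xget]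
   must return. *)
apply: xget_unique => [|v /graphE[rev imv]]; last first.
  by rewrite -[v]to_realK /to_real rev imv.
by apply/graphE/eq_col_mx; rewrite -/(to_real _) of_realK.
Qed.
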